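(* Let $\Omega\subset\mathbb{R}^2$ be a bounded domain with Lipschitz boundary, let $\mathsf{k}\in C^2(\mathbb{R}^2\times\mathbb{R}^2)$ be a positive definite symmetric kernel with associated reproducing kernel Hilbert spaces $\mathcal{H}(\Omega)$ and $\mathcal{H}(\partial\Omega)$, let $P_n=\{\mathbf{p}_1,\dots,\mathbf{p}_n\}\subset\Omega$ be a finite set of points, and let $\mathbf{g}\in[\mathcal{H}(\partial\Omega)]^2$. Consider the orthogonal decomposition $[\mathcal{H}(\Omega)]^2=V\oplus V^\perp$ with $V=\{\mathbf{u}\in[\mathcal{H}(\Omega)]^2:\mathcal{B}\mathbf{u}(\mathbf{p}_\ell)=0,\ \ell=1,\dots,n\}$. Let $\boldsymbol{\varphi}_{\mathbf{g}}\in[\mathcal{H}(\Omega)]^2$ be the solution of $$(\boldsymbol{\varphi}_{\mathbf{g}},\boldsymbol{\varphi})_{[\mathcal{H}]^2}=\int_{\partial\Omega}\mathbf{g}\cdot\boldsymbol{\varphi}\,ds\qquad\text{for all }\boldsymbol{\varphi}\in[\mathcal{H}(\Omega)]^2 ,$$ and for $\alpha>0$ let $\mathbf{u}_\alpha$ be the unique minimiser over $\mathbf{u}\in[\mathcal{H}(\Omega)]^2$ of $$\frac12\Big(\frac1n\sum_{\ell=1}^n|\mathcal{B}\mathbf{u}(\mathbf{p}_\ell)|^2+\alpha\|\mathbf{u}\|_{[\mathcal{H}]^2}^2\Big)-\alpha\int_{\partial\Omega}\mathbf{g}\cdot\mathbf{u}\,ds .$$ Write $\boldsymbol{\varphi}_{\mathbf{g}}=\boldsymbol{\varphi}_{\mathbf{g}}^{(1)}+\boldsymbol{\varphi}_{\mathbf{g}}^{(2)}$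 and $\mathbf{u}_\alpha=\mathbf{u}_\alpha^{(1)}+\mathbf{u}_\alpha^{(2)}$ with $\boldsymbol{\varphi}_{\mathbf{g}}^{(1)},\mathbf{u}_\alpha^{(1)}\in V$ and $\boldsymbol{\varphi}_{\mathbf{g}}^{(2)},\mathbf{u}_\alpha^{(2)}\in V^\perp$. Then: (i) $\mathbf{u}_\alpha^{(1)}=\boldsymbol{\varphi}_{\mathbf{g}}^{(1)}$ for all $\alpha>0$. (ii) There exists a constant $C>0$ independent of $\alpha$ and $n$ such that $\|\mathbf{u}_\alpha^{(2)}\|_{[\mathcal{H}]^2}\le C\|\mathbf{g}\|_{[\mathcal{H}(\partial\Omega)]^2}$. (iii) $\mathbf{u}_\alpha^{(2)}$ satisfies $$\frac1n\sum_{\ell=1}^n\mathcal{B}\mathbf{u}_\alpha^{(2)}(\mathbf{p}_\ell)\cdot\mathcal{B}\mathbf{v}^{(2)}(\mathbf{p}_\ell)+\alpha(\mathbf{u}_\alpha^{(2)},\mathbf{v}^{(2)})_{[\mathcal{H}]^2}=\alpha\int_{\partial\Omega}\mathbf{g}\cdot\mathbf{v}^{(2)}\,ds\qquad\text{for all }\mathbf{v}^{(2)}\in V^\perp .$$ (iv) As $\alpha\to0$: $\mathbf{u}_\alpha\to\boldsymbol{\varphi}_{\mathbf{g}}^{(1)}$ strongly in $[\mathcal{H}(\Omega)]^2$, and $\frac{1}{\sqrt\alpha}\max_{\mathbf{p}\in P_n}|\mathcal{B}\mathbf{u}_\alpha(\mathbf{p})|\to0$. (v) As $\alpha\to\infty$: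 $\mathbf{u}_\alpha\to\boldsymbol{\varphi}_{\mathbf{g}}$ strongly in $[\mathcal{H}(\Omega)]^2$.
   Context: A kernel $\mathsf{k}$ is positive definite if for every finite set of pairwise distinct points $\{\mathbf{x}_i\}$ the matrix $(\mathsf{k}(\mathbf{x}_i,\mathbf{x}_j))_{i,j}$ is positive definite. For $D\subset\mathbb{R}^2$, $\mathcal{H}(D)$ is the reproducing kernel Hilbert space of functions $D\to\mathbb{R}$ whose reproducing kernel is the restriction of $\mathsf{k}$ to $D\times D$: $\mathsf{k}(\mathbf{x},\cdot)\in\mathcal{H}(D)$ and $(\mathsf{k}(\mathbf{x},\cdot),f)_{\mathcal{H}}=f(\mathbf{x})$ for all $\mathbf{x}\in D$, $f\in\mathcal{H}(D)$. $[\mathcal{H}(D)]^2=\mathcal{H}(D)\times\mathcal{H}(D)$ with the product inner product $(\cdot,\cdot)_{[\mathcal{H}]^2}$ (matrix kernel $\mathsf{k}\,I_2$). Since $\mathsf{k}\in C^2$, functions in $\mathcal{H}(\Omega)$ have pointwise first partial derivatives at every point of $\Omega$. Boundary values on $\partial\Omega$ of functions in $\mathcal{H}(\Omega)$ are understood via the continuous trace operator $T=R\circ E:\mathcal{H}(\Omega)\to\mathcal{H}(\partial\Omega)$, where $E:\mathcal{H}(\Omega)\to\mathcal{H}(\overline\Omega)$ is the norm-preserving extension operator and $R:\mathcal{H}(\overline\Omega)\to\mathcal{H}(\partial\Omega)$ is restriction. The Cauchy-Riemann operator is $\mathcal{B}\mathbf{u}=(-\partial_x u_1+\partial_y u_2,\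 \partial_y u_1+\partial_x u_2)$ for $\mathbf{u}=(u_1,u_2)$. *)

(* Defs.v *)
From HB Require Import structures.
From mathcomp Require Import all_boot all_order all_algebra.
From mathcomp Require Import all_classical all_reals all_analysis.
Set Implicit Arguments.
Unset Strict Implicit.
Unset Printing Implicit Defensive.
Import Order.TTheory GRing.Theory Num.Theory.
Import numFieldNormedType.Exports.

Local Open Scope classical_set_scope.
Local Open Scope ring_scope.

(* The library norm of this product is the sup norm; Euclidean quantities are
   written with [edot] and [enorm]. *)
Definition plane (R : realType) : normedModType R := (R^o * R^o)%type.

Definition edot (R : realType) (x y : plane R) : R := x.1 * y.1 + x.2 * y.2.

Definition enorm (R : realType) (x : plane R) : R := Num.sqrt (edot x x).

Definition boundary (T : topologicalType) (A : set T) : set T :=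
  closure A `\` A°.

(* In finite dimension a function is C^n iff its iterated directional
   derivatives up to order [n] exist everywhere and are continuous. *)
Fixpoint class_C (R : realType) (V : normedModType R) (n : nat) (f : V -> R^o)
    : Prop :=
  continuous f /\
  if n is m.+1 then
    forall v, (forall x, derivable f x v) /\ class_C m ('D_v f : V -> R^o)
  else True.

(* Near each boundary point, in some rotated orthonormal frame with first axis
   [e], the set is the part of the plane lying strictly above the graph of a
   Lipschitz function. *)
Definition lipschitz_boundary (R : realType) (Omega : set (plane R)) : Prop :=
  forall q, boundary Omega q ->
    exists (e : plane R) (r : R) (gamma : R^o -> R^o),
      [/\ enorm e = 1, 0 < r, lipschitz gamma &
          forall x, ball q r x ->
            (Omega x <-> gamma (edot e x) < edot (- e.2, e.1) x)].

Definition bounded_lipschitz_domain (R : realType) (Omega : set (plane R))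
    : Prop :=
  [/\ open Omega, connected Omega, Omega !=set0, bounded_set Omega &
      lipschitz_boundary Omega].

Section hausdorff.
Context {R : realType}.
Local Open Scope ereal_scope.
Implicit Types (A U : set (plane R)) (F : (set (plane R))^nat).

(* The maximum with 0 only matters for the empty set. *)
Definition ediam U : \bar R :=
  maxe 0 (ereal_sup [set (enorm (x.1 - x.2))%:E | x in U `*` U]).

Definition fine_cover (d : R) A : set ((set (plane R))^nat) :=
  [set F | A `<=` \bigcup_i F i /\ forall i, ediam (F i) <= d%:E].

Definition hausdorff_content (d : R) A : \bar R :=
  ereal_inf [set \sum_(i <oo) ediam (F i) | F in fine_cover d A].

(* One-dimensional Hausdorff measure; on a rectifiable curve it is arc length,
   with no further normalising constant. *)
Definition hausdorff1 A : \bar R :=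
  ereal_sup [set hausdorff_content d A | d in [set d : R | (0 < d)%R]].

Lemma ediam_ge0 U : 0 <= ediam U.
Proof. by rewrite /ediam le_max lexx. Qed.

Lemma ediam0 : ediam set0 = 0.
Proof. by rewrite /ediam set0X image_set0 ereal_sup0 maxEge leNye. Qed.

Lemma hausdorff_content_ge0 d A : 0 <= hausdorff_content d A.
Proof.
apply: le_ereal_inf_tmp => _ [F _ <-].
by apply: nneseries_ge0 => *; exact: ediam_ge0.
Qed.

Lemma hausdorff_content_sigma_subadditive (d : R) :
  sigma_subadditive (hausdorff_content d).
Proof.
move=> A; have [[i ioo]|] := pselect (exists i, hausdorff_content d (A i) = +oo).
  rewrite (eseries_pinfty _ _ ioo) ?leey// => n _.
  by rewrite -ltNye (lt_le_trans _ (hausdorff_content_ge0 _ _)).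
rewrite -forallNE => Aoo.
suff add2e (e : {posnum R}) : hausdorff_content d (\bigcup_n A n) <=
    \sum_(i <oo) hausdorff_content d (A i) + e%:num%:E.
  by apply/lee_addgt0Pr => _/posnumP[].
rewrite (le_trans _ (epsilon_trick _ _ _))//; last first.
  by move=> n; exact: hausdorff_content_ge0.
pose P n F := fine_cover d (A n) F /\ \sum_(k <oo) ediam (F k) <=
  hausdorff_content d (A n) + (e%:num / (2 ^ n.+1)%:R)%:E.
have [G PG] : {G & forall n, P n (G n)}.
  apply: (@choice _ _ P) => n; rewrite /P /hausdorff_content.
  set S := (X in ereal_inf X); move infS : (ereal_inf S) => iS.
  case: iS infS => [r Sr|Soo|Soo].
  - have en1 : (0 < e%:num / (2 ^ n.+1)%:R)%R by [].
    have /(lb_ereal_inf_adherent en1) : ereal_inf S \is a fin_num by rewrite Sr.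
    move=> [x [B AnB muBx] xS].
    by exists B; split => //; rewrite muBx -Sr; exact/ltW.
  - by have := Aoo n; rewrite /hausdorff_content Soo.
  - suff : lbound S 0 by move/le_ereal_inf_tmp; rewrite Soo.
    move=> /= _ [B AnB <-].
    by apply: nneseries_ge0 => *; exact: ediam_ge0.
have muG_ge0 x : 0 <= (ediam \o uncurry G) x by exact: ediam_ge0.
apply: (@le_trans _ _ (\esum_(i in setT) (ediam \o uncurry G) i)).
  apply: ereal_inf_lbound => /=.
  have /card_esym/ppcard_eqP[f] := card_nat2.
  exists (uncurry G \o f).
    split=> [|i]; last first.
      by rewrite /=; case: (f i) => a b; exact: (PG a).1.2.
    move=> t [i _ /((PG i).1.1)[j _ Bijt]].
    by exists (f^-1%FUN (i, j)) => //=; rewrite invK ?inE.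
  rewrite -(esum_pred_image (ediam \o uncurry G) _ xpredT) ?[fun=> _]set_true//.
  by rewrite image_eq.
rewrite (_ : esum _ _ = \sum_(i <oo) \sum_(j <oo ) ediam (G i j)); last first.
  pose J : nat -> set (nat * nat) := fun i => [set (i, j) | j in setT].
  rewrite (_ : setT = \bigcup_k J k); last first.
    by rewrite predeqE => -[a b]; split => // _; exists a => //; exists b.
  rewrite esum_bigcupT /=; last 2 first.
    - apply/trivIsetP => i j _ _ ij.
      rewrite predeqE => -[n m] /=; split => //= -[] [_] _ [<-{n} _].
      by move=> [m' _] [] /esym/eqP; rewrite (negbTE ij).
    - by move=> /= [n m]; exact: ediam_ge0.
  rewrite -(image_id [set: nat]) -fun_true esum_pred_image//; last first.
    by move=> n _; apply: esum_ge0 => ? _; exact: ediam_ge0.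
  apply: eq_eseriesr => /= j _.
  rewrite -(esum_pred_image (ediam \o uncurry G) (pair j) predT)//=; last 2 first.
    by move=> *; exact: ediam_ge0.
    by move=> ? ? _ _; exact: (@can_inj _ _ _ snd).
  by congr esum; rewrite predeqE => -[a b]; split; move=> [i _ <-]; exists i.
apply: lee_lim.
- apply: is_cvg_nneseries => n *.
  by apply: nneseries_ge0 => m *; exact: (muG_ge0 (n, m)).
- by apply: is_cvg_nneseries => n *; apply: adde_ge0 => //;
    exact: hausdorff_content_ge0.
- by near=> n; apply: lee_sum => i _; exact: (PG i).2.
Unshelve. all: by end_near. Qed.

Lemma hausdorff1_ge0 A : 0 <= hausdorff1 A.
Proof.
apply: (le_trans (hausdorff_content_ge0 1 A)).
by apply: ereal_sup_ubound; exists 1%R => //=.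
Qed.

Lemma hausdorff1_set0 : hausdorff1 set0 = 0.
Proof.
apply/eqP; rewrite eq_le hausdorff1_ge0 andbT.
apply: ge_ereal_sup => _ [d /= d0 <-]; apply: ereal_inf_lbound.
exists (fun=> set0); first by split=> // i; rewrite ediam0 lee_fin ltW.
by rewrite eseries0// => *; exact: ediam0.
Qed.

Lemma le_hausdorff1 : {homo hausdorff1 : A B / A `<=` B >-> A <= B}.
Proof.
move=> A B AB; apply: ge_ereal_sup => _ [d d0 <-].
apply: (@le_trans _ _ (hausdorff_content d B)).
  apply: ereal_inf_le_tmp => x [F [BF Fd] <-]; exists F => //; split=> //.
  exact: subset_trans BF.
by apply: ereal_sup_ubound; exists d.
Qed.

Lemma hausdorff1_sigma_subadditive : sigma_subadditive hausdorff1.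
Proof.
move=> F; apply: ge_ereal_sup => _ [d d0 <-].
apply: (le_trans (hausdorff_content_sigma_subadditive _ _)).
apply: lee_nneseries => [i _ _|i _]; first exact: hausdorff_content_ge0.
by apply: ereal_sup_ubound; exists d.
Qed.

HB.instance Definition _ := isOuterMeasure.Build R (plane R) hausdorff1
  hausdorff1_set0 hausdorff1_ge0 le_hausdorff1 hausdorff1_sigma_subadditive.

Definition hausdorff1_outer : {outer_measure set (plane R) -> \bar R} :=
  hausdorff1.

(* [hausdorff1] is a metric outer measure, so its Caratheodory sigma-algebra
   contains the Borel sets. *)
Definition arc_length :
    {measure set (caratheodory_type hausdorff1_outer) -> \bar R} :=
  hausdorff1_outer.

End hausdorff.

Definition symmetric_kernel (R : realType) (T : Type) (k : T -> T -> R) : Prop :=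
  forall x y, k x y = k y x.

Definition positive_definite_kernel (R : realType) (T : Type)
    (k : T -> T -> R) : Prop :=
  forall (m : nat) (x : 'I_m -> T), injective x ->
    forall c : 'rV[R]_m, c != 0 ->
      0 < (c *m (\matrix_(i, j) k (x i) (x j)) *m c^T) 0 0.

(* A reproducing kernel Hilbert space of functions [D -> R]: a complete space
   whose norm comes from [inner], identified through the linear injection
   [rkhs_fun] with a space of functions on [D]. *)
Record rkhs (R : realType) (T : Type) (k : T -> T -> R) (D : set T) := Rkhs {
  rkhs_space :> completeNormedModType R ;
  inner : {dot rkhs_space for idfun} ;
  rkhs_fun : rkhs_space -> D -> R ;
  inner_norm : forall f, inner f f = `|f| ^+ 2 ;
  rkhs_fun_linear : forall (a : R) f g x,
    rkhs_fun (a *: f + g) x = a * rkhs_fun f x + rkhs_fun g x ;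
  rkhs_fun_inj : injective rkhs_fun ;
  reproducing : forall x : D, exists2 kx : rkhs_space,
    rkhs_fun kx = (fun y : D => k (\val x) (\val y)) &
    forall f, inner kx f = rkhs_fun f x
}.

Section rkhs_theory.
Context {R : realType} {T : Type} {k : T -> T -> R}.

(* The function represented by [f], with the junk value 0 outside [D]. *)
Definition rkhs_eval (D : set T) (H : rkhs k D) (f : H) : T -> R :=
  'valL_0 (rkhs_fun f).

Definition is_restriction (D D' : set T) (H : rkhs k D) (H' : rkhs k D')
    (r : H -> H') : Prop :=
  forall f x, D' x -> rkhs_eval (r f) x = rkhs_eval f x.

Definition is_isometric_extension (D D' : set T) (H : rkhs k D)
    (H' : rkhs k D') (e : H -> H') : Prop :=
  (forall f x, D x -> rkhs_eval (e f) x = rkhs_eval f x) /\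
  (forall f, `|e f| = `|f|).

Definition inner2 (D : set T) (H : rkhs k D) (u v : H * H) : R :=
  inner H u.1 v.1 + inner H u.2 v.2.

(* Not the library norm of [H * H], which is the maximum of the two norms. *)
Definition norm2 (D : set T) (H : rkhs k D) (u : H * H) : R :=
  Num.sqrt (inner2 u u).

Definition orthogonal_complement (D : set T) (H : rkhs k D) (V : set (H * H))
    : set (H * H) :=
  [set w | forall v, V v -> inner2 w v = 0].

End rkhs_theory.

Section cauchy_riemann.
Context {R : realType} {k : plane R -> plane R -> R}.

Definition partial_x (f : plane R -> R) (q : plane R) : R :=
  'D_((1, 0) : plane R) (f : plane R -> R^o) q.

Definition partial_y (f : plane R -> R) (q : plane R) : R :=
  'D_((0, 1) : plane R) (f : plane R -> R^o) q.

(* Meaningful at interior points of [D], where the values outside [D] play no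
   role. *)
Definition cauchy_riemann (D : set (plane R)) (H : rkhs k D) (u : H * H)
    (q : plane R) : plane R :=
  let u1 := rkhs_eval u.1 in
  let u2 := rkhs_eval u.2 in
  (- partial_x u1 q + partial_y u2 q, partial_y u1 q + partial_x u2 q).

Definition cauchy_riemann_kernel (D : set (plane R)) (H : rkhs k D) (n : nat)
    (p : 'I_n -> plane R) : set (H * H) :=
  [set u | forall l, cauchy_riemann u (p l) = 0].

Definition boundary_integral (Omega : set (plane R))
    (Hb : rkhs k (boundary Omega)) (g w : Hb * Hb) : R :=
  \int[arc_length]_(x in boundary Omega)
    (rkhs_eval g.1 x * rkhs_eval w.1 x + rkhs_eval g.2 x * rkhs_eval w.2 x).

Definition trace2 (Omega : set (plane R)) (H : rkhs k Omega)
    (Hc : rkhs k (closure Omega)) (Hb : rkhs k (boundary Omega))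
    (ext : H -> Hc) (res : Hc -> Hb) (u : H * H) : Hb * Hb :=
  (res (ext u.1), res (ext u.2)).

Definition energy (Omega : set (plane R)) (H : rkhs k Omega)
    (Hb : rkhs k (boundary Omega)) (tr : H * H -> Hb * Hb) (n : nat)
    (p : 'I_n -> plane R) (g : Hb * Hb) (alpha : R) (u : H * H) : R :=
  2^-1 * (n%:R^-1 * (\sum_(l < n) enorm (cauchy_riemann u (p l)) ^+ 2)
          + alpha * norm2 u ^+ 2)
  - alpha * boundary_integral g (tr u).

End cauchy_riemann.

(* Main.v *)
Require Import Defs.
From mathcomp Require Import all_boot all_order all_algebra.
From mathcomp Require Import all_classical all_reals all_analysis.
From mathcomp Require Import finmap ring lra.
Import Order.TTheory GRing.Theory Num.Theory.
Import numFieldNormedType.Exports.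
Set Implicit Arguments.
Unset Strict Implicit.
Unset Printing Implicit Defensive.

Local Open Scope classical_set_scope.
Local Open Scope ring_scope.

(** The minimisation is Tikhonov regularisation with a finite-rank penalty, and
    the heart of the proof is linear algebra with two positive semidefinite
    forms on [E = H * H]: the inner product [a] and the averaged
    Cauchy-Riemann form [q u v = 1/n sum_l Bu(p_l) . Bv(p_l)], whose null space
    is [V].  As [a phi] represents the boundary functional, the energy is
    [1/2 (q u u + alpha a u u) - alpha a phi u], and its minimisers satisfy
    [q u v + alpha a u v = alpha a phi v] for all [v]
    ([tikhonov_euler_lagrange]).

    Testing with [v] in [V] removes [q], so that [u1 - phi1] is orthogonal to
    [V] and (i) follows ([tikhonov_null_part]); what remains is the same
    equation for [u2] with datum [phi2] ([tikhonov_perp_part]), which is (iii).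
    Testing it with [u2] gives [|u2| <= |phi2|] ([tikhonov_contraction]), and
    testing with [u2 - phi2] gives [|u2 - phi2|^2 <= q phi2 phi2 / alpha]
    ([tikhonov_large]), hence (v).  For (iv), [phi2] is orthogonal to the common
    kernel of finitely many linear functionals and is therefore a combination
    of them ([dominated_of_common_kernel]), so [(a phi2 v)^2 <= c q v v]; with
    this source condition the equation tested with [u2] yields
    [|u2|^2 <= c alpha] and [q u2 u2 <= c alpha^2] ([tikhonov_small]).

    Two analytic facts feed this algebra.  First, [u |-> Bu(p)] is linear,
    which requires the elements of [H] to have partial derivatives: the
    difference quotients of the kernel sections have inner products equal to
    mixed second difference quotients of [k], which converge because [k] is
    C^2, so tested against a fixed [f] they form a Cauchy family
    ([rkhs_derivable]).  Second, the constant in (ii) must depend neither on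
    [n] nor on [alpha]; as [|u2| <= |phi2|] and
    [|phi2|^2 = int g . tr phi2], it suffices to bound the boundary integral by
    [C |g| |v|].  By the reproducing property the integrand is at most
    [sup k(q,q) |g| |v|], so it remains to see that the boundary has finite
    length ([boundary_finite_length]): it is compact and locally lies on a
    Lipschitz graph, which the abscissa charts with a Lipschitz inverse
    ([hausdorff1_le_chart]). *)

(** * Positive semidefinite forms and Tikhonov regularisation *)

Section psd_forms.
Context {R : realFieldType} {E : lmodType R}.
Implicit Types (a q : E -> E -> R) (u v w : E).

Definition psd_form a : Prop :=
  [/\ forall u v, a u v = a v u,
      forall t u v w, a (t *: u + v) w = t * a u w + a v w &
      forall u, 0 <= a u u].

Section psd_form_theory.
Variables (a : E -> E -> R) (ha : psd_form a).

Lemma psd_formC u v : a u v = a v u. Proof. by case: ha. Qed.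

Lemma psd_form_ge0 u : 0 <= a u u. Proof. by case: ha. Qed.

Lemma psd_formDl u v w : a (u + v) w = a u w + a v w.
Proof. by case: ha => _ lin _; rewrite -{1}[u]scale1r lin mul1r. Qed.

Lemma psd_form0l w : a 0 w = 0.
Proof. by apply: (@addrI _ (a 0 w)); rewrite -psd_formDl !addr0. Qed.

Lemma psd_formZl t u w : a (t *: u) w = t * a u w.
Proof. by case: ha => _ lin _; rewrite -[t *: u]addr0 lin psd_form0l addr0. Qed.

Lemma psd_formBl u v w : a (u - v) w = a u w - a v w.
Proof. by rewrite -scaleN1r psd_formDl psd_formZl mulN1r. Qed.

Lemma psd_formDr u v w : a w (u + v) = a w u + a w v.
Proof. by rewrite !(psd_formC w) psd_formDl. Qed.

Lemma psd_formZr t u w : a w (t *: u) = t * a w u.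
Proof. by rewrite !(psd_formC w) psd_formZl. Qed.

Lemma psd_formBr u v w : a w (u - v) = a w u - a w v.
Proof. by rewrite !(psd_formC w) psd_formBl. Qed.

Lemma psd_form_expand t u v :
  a (u + t *: v) (u + t *: v) = a u u + 2 * t * a u v + t ^+ 2 * a v v.
Proof.
rewrite psd_formDl !psd_formDr !psd_formZl !psd_formZr (psd_formC v u); ring.
Qed.

(** The form may be degenerate, so the usual minimisation over [u + t v] needs
    a separate argument for isotropic [v]. *)
Lemma psd_cauchy_schwarz u v : a u v ^+ 2 <= a u u * a v v.
Proof.
have [v0|v0] := eqVneq (a v v) 0; last first.
  have vpos : 0 < a v v by rewrite lt_def v0 psd_form_ge0.
  have := psd_form_ge0 (u + (- (a u v / a v v)) *: v).
  rewrite psd_form_expand.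
  have -> : a u u + 2 * - (a u v / a v v) * a u v + (- (a u v / a v v)) ^+ 2 * a v v
    = (a u u * a v v - a u v ^+ 2) / a v v by field.
  by rewrite pmulr_lge0 ?invr_gt0// subr_ge0.
(* For isotropic v the square of u + t v is affine in t, hence unbounded below
   unless u is orthogonal to v; this t makes it equal to -1. *)
have [->|uv0] := eqVneq (a u v) 0; first by rewrite expr0n v0 mulr0.
have := psd_form_ge0 (u + (- ((a u u + 1) / (2 * a u v))) *: v).
rewrite psd_form_expand v0.
have -> : a u u + 2 * - ((a u u + 1) / (2 * a u v)) * a u v +
  (- ((a u u + 1) / (2 * a u v))) ^+ 2 * 0 = - 1 by field.
by rewrite lerNr oppr0 ler10.
Qed.

Lemma psd_null u v : a v v = 0 -> a u v = 0.
Proof.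
move=> v0; apply/eqP; rewrite -sqrf_eq0 eq_le sqr_ge0 andbT.
by have := psd_cauchy_schwarz u v; rewrite v0 mulr0.
Qed.

End psd_form_theory.

(** The first-order condition at a minimum: a polynomial [t b + t^2 c] that is
    nowhere negative has no linear term. *)
Lemma quadratic_ge0_linear_coef (b c : R) :
  0 <= c -> (forall t, 0 <= t * b + t ^+ 2 * c) -> b = 0.
Proof.
move=> c0 /(_ (- b / (c + 1))).
have c1 : 0 < c + 1 by rewrite ltr_wpDl.
have -> : - b / (c + 1) * b + (- b / (c + 1)) ^+ 2 * c = - (b / (c + 1)) ^+ 2.
  by field; rewrite gt_eqF.
rewrite oppr_ge0 => h; apply/eqP.
have : b / (c + 1) == 0 by rewrite -sqrf_eq0 eq_le h sqr_ge0.
by rewrite mulf_eq0 invr_eq0 (gt_eqF c1) orbF.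
Qed.

Section tikhonov.
Variables (a q : E -> E -> R) (ha : psd_form a) (hq : psd_form q).
Variables (phi : E) (alpha : R).
Hypothesis alpha0 : 0 < alpha.

Definition tikhonov w : R := 2^-1 * (q w w + alpha * a w w) - alpha * a phi w.

Lemma tikhonov_euler_lagrange u : (forall w, tikhonov u <= tikhonov w) ->
  forall v, q u v + alpha * a u v = alpha * a phi v.
Proof.
move=> min v; apply/eqP; rewrite -subr_eq0; apply/eqP.
apply: (@quadratic_ge0_linear_coef _ (2^-1 * (q v v + alpha * a v v))).
  apply: mulr_ge0; first by rewrite invr_ge0.
  apply: addr_ge0; first exact: (psd_form_ge0 hq v).
  exact: mulr_ge0 (ltW alpha0) (psd_form_ge0 ha v).
move=> t; have := min (u + t *: v); rewrite -subr_ge0 /tikhonov.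
rewrite (psd_form_expand ha) (psd_form_expand hq) (psd_formDr ha) (psd_formZr ha).
by congr (0 <= _); field.
Qed.

Variables (phi1 phi2 u1 u2 : E).
Hypothesis definite : forall v, a v v = 0 -> v = 0.
Hypothesis phiE : phi = phi1 + phi2.
Hypothesis null_phi1 : q phi1 phi1 = 0.
Hypothesis perp_phi2 : forall v, q v v = 0 -> a phi2 v = 0.
Hypothesis null_u1 : q u1 u1 = 0.
Hypothesis perp_u2 : forall v, q v v = 0 -> a u2 v = 0.
Hypothesis el : forall v, q (u1 + u2) v + alpha * a (u1 + u2) v = alpha * a phi v.

(** Testing with [u1 - phi1], which lies in the null space of [q], makes both the
    penalty and the orthogonal parts [u2] and [phi2] disappear. *)
Lemma tikhonov_null_part : u1 = phi1.
Proof.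
apply/eqP; rewrite -subr_eq0; apply/eqP/definite.
have null : q (u1 - phi1) (u1 - phi1) = 0.
  by rewrite (psd_formBr hq) (psd_null hq _ null_u1) (psd_null hq _ null_phi1) subrr.
have e : a u1 (u1 - phi1) = a phi1 (u1 - phi1).
  apply: (mulfI (lt0r_neq0 alpha0)); have := el (u1 - phi1).
  rewrite (psd_null hq _ null) add0r phiE !(psd_formDl ha).
  by rewrite perp_u2// perp_phi2// !addr0.
by rewrite (psd_formBl ha) e subrr.
Qed.

Lemma tikhonov_perp_part v :
  q u2 v + alpha * a u2 v = alpha * a phi2 v.
Proof.
have := el v; rewrite phiE tikhonov_null_part !(psd_formDl ha) (psd_formDl hq).
rewrite (psd_formC hq phi1) (psd_null hq _ null_phi1) add0r !mulrDr addrCA.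
exact: addrI.
Qed.

End tikhonov.

Section tikhonov_bounds.
Variables (a q : E -> E -> R) (ha : psd_form a) (hq : psd_form q).
Variables (phi2 u2 : E) (alpha : R).
Hypothesis alpha0 : 0 < alpha.
Hypothesis el : forall v, q u2 v + alpha * a u2 v = alpha * a phi2 v.

(** Testing with [u2] itself: dropping [q u2 u2 >= 0] leaves
    [a u2 u2 <= a phi2 u2], and Cauchy-Schwarz concludes. *)
Lemma tikhonov_contraction : a u2 u2 <= a phi2 phi2.
Proof.
have le1 : a u2 u2 <= a phi2 u2.
  by rewrite -(ler_pM2l alpha0) -el lerDr (psd_form_ge0 hq).
have := psd_cauchy_schwarz ha phi2 u2.
have [->|u0] := eqVneq (a u2 u2) 0; first by rewrite (psd_form_ge0 ha).
have upos : 0 < a u2 u2 by rewrite lt_def u0 (psd_form_ge0 ha).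
move=> cs; rewrite -(ler_pM2r upos); apply: le_trans cs.
by rewrite -expr2 ler_pXn2r// nnegrE ?(le_trans (ltW upos)).
Qed.

(** Put [x = a phi2 u2]; testing with [u2] gives [Q + alpha A = alpha x] for
    [A = a u2 u2] and [Q = q u2 u2].  The source condition [x^2 <= c Q] then
    bounds first [Q], from [Q <= alpha x], and then [A], from [A <= x]. *)
Lemma tikhonov_small (c : R) : 0 <= c ->
  (forall v, a phi2 v ^+ 2 <= c * q v v) ->
  a u2 u2 <= c * alpha /\ q u2 u2 <= c * alpha ^+ 2.
Proof.
move=> c0 /(_ u2) src; have := el u2.
have := psd_form_ge0 ha u2; have := psd_form_ge0 hq u2.
move: src; set A := a u2 u2; set Q := q u2 u2; set x := a phi2 u2.
move=> src Q0 A0 e.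
have Qx : Q <= alpha * x by rewrite -e lerDl mulr_ge0// ltW.
have Ax : A <= x by rewrite -(ler_pM2l alpha0) -e lerDr.
have Qle : Q <= c * alpha ^+ 2.
  have [->|Qn0] := eqVneq Q 0; first by rewrite mulr_ge0 ?sqr_ge0.
  have Qpos : 0 < Q by rewrite lt_def Qn0.
  rewrite -(ler_pM2r Qpos); apply: (@le_trans _ _ ((alpha * x) ^+ 2)).
    by rewrite -expr2; apply: lerXn2r; rewrite ?nnegrE ?(le_trans Q0).
  have -> : c * alpha ^+ 2 * Q = alpha ^+ 2 * (c * Q) by ring.
  by rewrite exprMn ler_wpM2l ?sqr_ge0.
split=> //; have ca0 : 0 <= c * alpha := mulr_ge0 c0 (ltW alpha0).
rewrite -(@ler_pXn2r _ 2)// ?nnegrE//.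
apply: (@le_trans _ _ (x ^+ 2)); first by apply: lerXn2r; rewrite ?nnegrE ?(le_trans A0).
have -> : (c * alpha) ^+ 2 = c * (c * alpha ^+ 2) by ring.
by rewrite (le_trans src)// ler_wpM2l.
Qed.

(** Testing with [u2 - phi2] gives
    [alpha |u2 - phi2|^2 = q u2 phi2 - q u2 u2], and the right-hand side is at
    most [q phi2 phi2 / 4] because [q] is nonnegative at [phi2 - 2 u2]. *)
Lemma tikhonov_large :
  a (u2 - phi2) (u2 - phi2) <= q phi2 phi2 / alpha.
Proof.
rewrite ler_pdivlMr// mulrC.
have -> : alpha * a (u2 - phi2) (u2 - phi2) = q u2 phi2 - q u2 u2.
  rewrite (psd_formBl ha) mulrBr -(el (u2 - phi2)) (psd_formBr hq); ring.
have := psd_form_ge0 hq (phi2 + (- 2) *: u2).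
have := psd_form_ge0 hq phi2.
rewrite (psd_form_expand hq) (psd_formC hq phi2); lra.
Qed.

End tikhonov_bounds.
End psd_forms.

(** A linear functional vanishing on the common kernel of finitely many others is
    a combination of them.  Only the resulting quadratic bound is stated: it
    is what a source condition asks for, and it makes the induction on [s]
    insensitive to repetitions in [s]. *)
Lemma dominated_of_common_kernel (R : realFieldType) (E : lmodType R)
    (I : eqType) (b : I -> E -> R) (s : seq I) (f : E -> R) :
  (forall i, scalar (b i)) -> scalar f ->
  (forall v, (forall i, i \in s -> b i v = 0) -> f v = 0) ->
  exists2 c, 0 <= c & forall v, f v ^+ 2 <= c * \sum_(i <- s) b i v ^+ 2.
Proof.
move=> blin; elim: s f => [|i s IH] f flin fker.
  by exists 0 => // v; rewrite fker// expr0n mul0r.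
have [[e [es ei]]|noe] := pselect (exists e,
    (forall j, j \in s -> b j e = 0) /\ b i e != 0); last first.
  have [v vs|c c0 hc] := IH f flin.
    apply: fker => j; rewrite inE => /predU1P[->|]; last exact: vs.
    by apply: contrapT => /eqP biv; apply: noe; exists v.
  exists c => // v; apply: (le_trans (hc v)).
  by rewrite big_cons ler_wpM2l// lerDr sqr_ge0.
(* Subtracting a multiple of b i that cancels f at e leaves a functional that
   vanishes on the common kernel of the tail alone. *)
pose t := f e / b i e.
have lin_comb (h : E -> R) : scalar h ->
    forall v, h (- (b i v / b i e) *: e + v) = h v - b i v / b i e * h e.
  by move=> hlin v; rewrite hlin mulNr addrC.
have [r v w|v vs|c c0 hc] := IH (fun v => f v - t * b i v).
- by rewrite flin blin; ring.
- have <- : f (- (b i v / b i e) *: e + v) = f v - t * b i v.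
    by rewrite lin_comb// /t; field.
  apply: fker => j; rewrite inE => /predU1P[->|js].
    by rewrite lin_comb// divfK// subrr.
  by rewrite lin_comb// (vs j js) (es j js) mulr0 subr0.
exists (2 * t ^+ 2 + 2 * c); first by have := sqr_ge0 t; lra.
move=> v; rewrite big_cons; have := hc v.
have : 0 <= \sum_(j <- s) b j v ^+ 2 by rewrite sumr_ge0// => j _; exact: sqr_ge0.
set S := \sum_(_ <- _) _ => S0 hS.
have := sqr_ge0 (f v - t * b i v - t * b i v).
have := mulr_ge0 (sqr_ge0 t) S0; have := mulr_ge0 c0 (sqr_ge0 (b i v)).
by move: hS; rewrite !expr2; nra.
Qed.

(** * Reproducing kernel Hilbert spaces *)

Section rkhs_basics.
Context {R : realType} {T : Type} {k : T -> T -> R} {D : set T}.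
Variable H : rkhs k D.

Lemma inner_psd : psd_form (inner H).
Proof.
split=> [u v|t u v w|u]; last by rewrite inner_norm sqr_ge0.
  by rewrite hermC expr0 mul1r.
by rewrite linearPl.
Qed.

Lemma inner2_psd : psd_form (@inner2 R T k D H).
Proof.
have h := inner_psd; rewrite /inner2; split=> [u v|t u v w|u].
- by rewrite !(psd_formC h u.1) !(psd_formC h u.2).
- by rewrite /= !(psd_formDl h) !(psd_formZl h); ring.
- by rewrite addr_ge0 ?(psd_form_ge0 h).
Qed.

Lemma inner2_definite (u : H * H) : inner2 u u = 0 -> u = 0.
Proof.
case: u => u1 u2; rewrite /inner2 /= !inner_norm => /eqP.
rewrite paddr_eq0 ?sqr_ge0// !sqrf_eq0 !normr_eq0 => /andP[/eqP-> /eqP->].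
by [].
Qed.

Lemma norm2_sqr (u : H * H) : norm2 u ^+ 2 = inner2 u u.
Proof. by rewrite sqr_sqrtr// (psd_form_ge0 inner2_psd). Qed.

Lemma rkhs_eval_scalar (q : T) : scalar (fun f : H => rkhs_eval f q).
Proof.
move=> t f g; rewrite /rkhs_eval /=.
by case: ('oinv_set_val q) => [y|] /=; rewrite ?rkhs_fun_linear// mulr0 addr0.
Qed.

Lemma rkhs_eval_val (f : H) (x : D) : rkhs_eval f (\val x) = rkhs_fun f x.
Proof.
have /(congr1 (fun h => h x)) := @valLK _ _ (0 : R) D (rkhs_fun f).
by [].
Qed.

(** The kernel section at a point, expressed with [rkhs_eval] so that no proof
    of membership in [D] is carried along. *)
Lemma reproducing_section (q : T) : D q -> exists2 kq : H,
  forall y, D y -> rkhs_eval kq y = k q y &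
  forall f, inner H kq f = rkhs_eval f q.
Proof.
move=> /mem_set Dq; have [kq kqE kqf] := @reproducing _ _ _ _ H (SigSub Dq).
exists kq => [y /mem_set Dy|f]; last by rewrite kqf -rkhs_eval_val.
by rewrite -[y]/(\val (SigSub Dy : D)) rkhs_eval_val kqE.
Qed.

Lemma rkhs_eval_bound (q : T) (f : H) :
  D q -> rkhs_eval f q ^+ 2 <= k q q * `|f| ^+ 2.
Proof.
move=> Dq; have [kq kqE kqf] := reproducing_section Dq.
rewrite -kqf -inner_norm -(kqE _ Dq) -kqf.
exact: psd_cauchy_schwarz inner_psd _ _.
Qed.

End rkhs_basics.

(** * Differentiability of functions in the reproducing kernel space *)

Section along_line.
Context {R : realType} {V : normedModType R}.

Lemma is_derive_along_line (F : V -> R^o) (z w : V) (s : R) :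
  derivable F (z + s *: w) w ->
  is_derive s (1 : R) (fun r : R => F (z + r *: w) : R) ('D_w F (z + s *: w)).
Proof.
move=> dF.
have E : (fun h : R => h^-1 *: ((F \o shift (z + s *: w)) (h *: w) - F (z + s *: w)))
  = (fun h : R => h^-1 *: (((fun r : R => F (z + r *: w) : R^o) \o shift s)
      (h *: (1 : R)) - (F (z + s *: w) : R^o))).
  by apply/funext => h /=; rewrite [h *: 1]mulr1 scalerDl addrCA addrA.
by split; [rewrite /derivable -E | rewrite /derive -E].
Qed.

(** The bound on absolute values treats both signs of [s] at once: increments of
    either sign occur in a difference quotient. *)
Lemma mvt_at_origin (f df : R -> R) (s : R) :
  (forall r : R, is_derive r (1 : R) f (df r)) ->
  exists2 c, `|c| <= `|s| & f s - f 0 = df c * s.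
Proof.
move=> h.
have cont (I : interval R) : {within [set` I], continuous f}.
  by apply: derivable_within_continuous => x _; exact: ex_derive.
have [s0|s0] := leP 0 s.
  have [c /itvP c0 e] := MVT_segment s0 (fun x _ => h x) (cont _).
  by exists c; rewrite ?ger0_norm ?c0// e subr0.
have [c /itvP c0 e] := MVT_segment (ltW s0) (fun x _ => h x) (cont _).
exists c; first by rewrite !ler0_norm ?lerN2 ?c0// ltW.
by rewrite -opprB e sub0r mulrN opprK.
Qed.

End along_line.

Section mixed_differences.
Context {R : realType} {V : normedModType R}.

(** Two applications of the mean value theorem, as in the proof of Schwarz's
    theorem: first in [s] to the difference of [k] at the two values of the
    second argument, then in [t] to the resulting first derivative. *)
Lemma mixed_difference_mvt (k : V -> V -> R) (p v : V) (s t : R) :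
  class_C 2 (fun z : V * V => k z.1 z.2 : R^o) ->
  exists c d, [/\ `|c| <= `|s|, `|d| <= `|t| &
    k (p + s *: v) (p + t *: v) - k (p + s *: v) p - (k p (p + t *: v) - k p p)
    = 'D_((0, v) : V * V) ('D_((v, 0) : V * V)
        (fun z : V * V => k z.1 z.2 : R^o)) (p + c *: v, p + d *: v) * t * s].
Proof.
set F := (fun z : V * V => _) => -[_ /(_ (v, 0))[dF [_ /(_ (0, v))[ddF _]]]].
set w1 : V * V := (v, 0); set w2 : V * V := (0, v).
have d1 z r : is_derive r (1 : R) (fun r => F (z + r *: w1) : R) ('D_w1 F (z + r *: w1)).
  by apply: is_derive_along_line; exact: dF.
have d2 z r : is_derive r (1 : R) (fun r => 'D_w1 F (z + r *: w2) : R)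
    ('D_w2 ('D_w1 F) (z + r *: w2)).
  by apply: is_derive_along_line; exact: ddF.
have dd r := is_deriveB (d1 (p, p + t *: v) r) (d1 (p, p) r).
have [c cs e1] := mvt_at_origin s dd.
have [d dt e2] := mvt_at_origin t (d2 ((p, p) + c *: w1)).
exists c, d; split => //.
have shift1 x y r : (x, y) + r *: w1 = (x + r *: v, y).
  by congr pair; rewrite /= ?scaler0 ?addr0.
have shift2 x y r : (x, y) + r *: w2 = (x, y + r *: v).
  by congr pair; rewrite /= ?scaler0 ?addr0.
move: e1 e2; rewrite !fctE !shift1 !shift2 !scale0r !addr0 => e1 e2.
by rewrite -e2 -e1 /F /=; ring.
Qed.

Lemma nbhs_line (A : set V) (p v : V) : nbhs p A ->
  exists2 delta : R, 0 < delta & forall c, `|c| < delta -> A (p + c *: v).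
Proof.
move=> /nbhs_ballP[e /= e0 eA]; exists (e / (`|v| + 1)) => [|c ce].
  by rewrite divr_gt0// ltr_wpDl.
apply: eA; rewrite -ball_normE /= opprD addNKr normrN normrZ.
rewrite (le_lt_trans (y := `|c| * (`|v| + 1)))//.
  by rewrite ler_wpM2l// lerDl.
by rewrite -ltr_pdivlMr// ltr_wpDl.
Qed.

(** The two increments [s] and [t] tend to 0 independently; this uniformity is
    what a Cauchy estimate needs.  The limit [m] is the mixed derivative of
    [k] at [(p, p)]. *)
Lemma mixed_difference_quotient_limit (k : V -> V -> R) (p v : V) :
  class_C 2 (fun z : V * V => k z.1 z.2 : R^o) ->
  exists m : R, forall e : R, 0 < e -> exists2 delta : R, 0 < delta &
    forall s t : R, `|s| < delta -> `|t| < delta -> s != 0 -> t != 0 ->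
    `|(k (p + s *: v) (p + t *: v) - k (p + s *: v) p
       - (k p (p + t *: v) - k p p)) / (s * t) - m| <= e.
Proof.
move=> kC2; set DDk := 'D_((0, v) : V * V) ('D_((v, 0) : V * V)
  (fun z : V * V => k z.1 z.2 : R^o)).
have DDk_cont : continuous DDk by case: kC2 => _ /(_ (v, 0))[_ [_ /(_ (0, v))[_ []]]].
exists (DDk (p, p)) => e e0.
have /cvgrPdist_le/(_ e e0)/nbhs_ballP[r r0 rP] := DDk_cont (p, p).
have [delta delta0 deltaP] := nbhs_line v (nbhsx_ballx p r r0).
exists delta => // s t sd td s0 t0.
have [c [d [cs dt ->]]] := mixed_difference_mvt p v s t kC2.
rewrite -mulrA [t * s]mulrC mulfK ?mulf_neq0// distrC; apply: rP; split.
  by apply: deltaP; exact: le_lt_trans sd.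
by apply: deltaP; exact: le_lt_trans td.
Qed.

End mixed_differences.

Section rkhs_differentiability.
Context {R : realType} {V : normedModType R} {k : V -> V -> R} {D : set V}.
Variables (H : rkhs k D) (kC2 : class_C 2 (fun z : V * V => k z.1 z.2 : R^o)).

(** The difference quotient of [f] at [p] is the inner product of [f] with the
    difference quotient of the kernel sections at [p].  The Gram matrix of the
    latter consists of mixed second difference quotients of [k], all close to
    one number [m], so their mutual distances [m - 2 m + m] are small and the
    quotients of [f] form a Cauchy family. *)
Lemma rkhs_derivable (f : H) (p v : V) :
  nbhs p D -> derivable (rkhs_eval f : V -> R^o) p v.
Proof.
move=> Dp; have Dp' : D p by exact: nbhs_singleton Dp.
have a := inner_psd H.
have [m mP] := mixed_difference_quotient_limit p v kC2.
have [r r0 rD] := nbhs_line v Dp.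
pose dq (h : R) := h^-1 * (rkhs_eval f (p + h *: v) - rkhs_eval f p).
have dq_cauchy (e : R) : 0 < e -> exists2 delta : R, 0 < delta & forall s t : R,
    `|s| < delta -> `|t| < delta -> s != 0 -> t != 0 ->
    (dq s - dq t) ^+ 2 <= 4 * e * `|f| ^+ 2.
  move=> /mP[delta delta0 deltaP]; exists (Num.min r delta); first by rewrite lt_min r0.
  move=> s t; rewrite !lt_min => /andP[sr sd] /andP[tr td] s0 t0.
  have [kp kpE kpf] := reproducing_section H Dp'.
  have [ks ksE ksf] := reproducing_section H (rD _ sr).
  have [kt ktE ktf] := reproducing_section H (rD _ tr).
  have Ds := rD _ sr; have Dt := rD _ tr.
  have -> : dq s - dq t = inner H (s^-1 *: (ks - kp) - t^-1 *: (kt - kp)) f.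
    rewrite (psd_formBl a) !(psd_formZl a) !(psd_formBl a).
    by rewrite kpf ksf ktf.
  apply: le_trans (psd_cauchy_schwarz a _ _) _; rewrite (inner_norm f).
  apply: ler_wpM2r; first exact: sqr_ge0.
  set ds := s^-1 *: (ks - kp); set dt := t^-1 *: (kt - kp).
  have := deltaP s s sd sd s0 s0; have := deltaP s t sd td s0 t0.
  have := deltaP t t td td t0 t0; rewrite !ler_distl.
  have <- : inner H dt dt = (k (p + t *: v) (p + t *: v) - k (p + t *: v) p
      - (k p (p + t *: v) - k p p)) / (t * t).
    rewrite (psd_formZl a) (psd_formZr a) (psd_formBl a) !(psd_formBr a).
    by rewrite !ktf !kpf !ktE// !kpE//; field.
  have <- : inner H dt ds = (k (p + s *: v) (p + t *: v) - k (p + s *: v) p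
      - (k p (p + t *: v) - k p p)) / (s * t).
    rewrite (psd_formZl a) (psd_formZr a) (psd_formBl a) !(psd_formBr a).
    by rewrite !ktf !kpf !ksE// !kpE//; field; apply/andP.
  have <- : inner H ds ds = (k (p + s *: v) (p + s *: v) - k (p + s *: v) p
      - (k p (p + s *: v) - k p p)) / (s * s).
    rewrite (psd_formZl a) (psd_formZr a) (psd_formBl a) !(psd_formBr a).
    by rewrite !ksf !kpf !ksE// !kpE//; field.
  move=> /andP[_ tt] /andP[st _] /andP[_ ss].
  rewrite (psd_formBl a) !(psd_formBr a) (psd_formC a ds dt); lra.
rewrite /derivable.
have -> : (fun h : R => h^-1 *: (((rkhs_eval f : V -> R^o) \o shift p) (h *: v)
    - (rkhs_eval f : V -> R^o) p)) = (dq : R -> R^o).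
  by apply/funext => h; rewrite /dq /= [h *: v + p]addrC.
apply/cauchy_cvgP; apply: cauchy_exP => e e0.
(* The added 1 covers f = 0 and makes the final inequality strict. *)
pose c := 4 * (`|f| ^+ 2 + 1).
have c0 : 0 < c by rewrite mulr_gt0// ltr_wpDl// sqr_ge0.
have [|delta delta0 deltaP] := dq_cauchy (e ^+ 2 / c).
  by rewrite divr_gt0// exprn_gt0.
have h2 : `|delta / 2| < delta by rewrite gtr0_norm ?divr_gt0//; lra.
exists (dq (delta / 2)).
suff : \forall h \near 0^', ball (dq (delta / 2) : R^o) e (dq h) by [].
near=> h; rewrite -ball_normE /=.
have hd : `|h| < delta.
  near: h; apply: nbhs_dnbhs; apply/nbhs_ballP; exists delta => // x.
  by rewrite -ball_normE /= sub0r normrN.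
have h0 : h != 0 by near: h; exact: nbhs_dnbhs_neq.
have d20 : delta / 2 != 0 by rewrite mulf_neq0 ?invr_neq0 ?gt_eqF.
rewrite -(@ltr_pXn2r _ 2)// ?nnegrE ?(ltW e0)// real_normK ?num_real//.
apply: (le_lt_trans (deltaP _ _ h2 hd d20 h0)).
rewrite -subr_gt0.
have -> : e ^+ 2 - 4 * (e ^+ 2 / c) * `|f| ^+ 2 = 4 * e ^+ 2 / c.
  rewrite /c; field; rewrite gt_eqF// ltr_wpDl// sqr_ge0.
by rewrite divr_gt0// mulr_gt0// exprn_gt0.
Unshelve. all: by end_near. Qed.

End rkhs_differentiability.

(** * Length of a Lipschitz boundary *)

Section boundary_length.
Context {R : realType}.
Implicit Types (A S Omega : set (plane R)).

Lemma plane_normE (x : plane R) : `|x| = Num.max `|x.1| `|x.2|.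
Proof. exact: prod_normE. Qed.

Lemma boundary_compact Omega : bounded_set Omega -> compact (boundary Omega).
Proof.
move=> /pinfty_ex_gt0[M M0 OM].
pose B : set (plane R) := `[- M, M]%classic `*` `[- M, M]%classic.
have cB : compact B by apply: compact_setX; exact: segment_compact.
have OB : closure Omega `<=` B.
  have clB : closed B by apply: compact_closed => //; exact: norm_hausdorff.
  rewrite [X in _ `<=` X](closure_id B).1//; apply: closure_subset => x /OM.
  rewrite /= plane_normE ge_max !ler_norml => /andP[x1 x2].
  by split; rewrite /= in_itv.
apply: (subclosed_compact _ cB) => [|x [/OB]//].
rewrite /boundary setDE; apply: closedI; first exact: closed_closure.
by apply: open_closedC; exact: open_interior.
Qed.

Lemma boundaryE Omega : open Omega -> boundary Omega = closure Omega `\` Omega.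
Proof. by rewrite /boundary => /interior_id ->. Qed.

(** Cutting [[a, b[] into [N] equal pieces cuts [S] into pieces of diameter at
    most [K (b - a) / N]: their diameters add up to [K (b - a)] for every [N],
    and [N] can be chosen to meet any given fineness. *)
Lemma hausdorff1_le_chart S (c : plane R -> R) (K a b : R) :
  0 < K -> a < b ->
  (forall x, S x -> a <= c x < b) ->
  (forall x y, S x -> S y -> enorm (x - y) <= K * `|c x - c y|) ->
  (hausdorff1 S <= (K * (b - a))%:E)%E.
Proof.
move=> K0 ab cab cK; apply: ge_ereal_sup => _ [d /= d0 <-].
have ba : 0 < b - a by rewrite subr_gt0.
pose N := (Num.truncn (K * (b - a) / d)).+1.
pose h := (b - a) / N%:R.
have N0 : 0 < N%:R :> R by [].
have h0 : 0 < h by rewrite divr_gt0.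
have Khd : K * h <= d.
  rewrite /h mulrA ler_pdivrMr// [d * _]mulrC -ler_pdivrMr// ltW//.
  exact: truncnS_gt.
pose F i : set (plane R) :=
  if (i < N)%N then S `&` [set x | a + i%:R * h <= c x <= a + i.+1%:R * h] else set0.
have Fd i : (ediam (F i) <= (K * h)%:E)%E.
  have Kh0 : (0 <= (K * h)%:E)%E by rewrite lee_fin mulr_ge0// ltW.
  rewrite /ediam ge_max Kh0 /=; apply: ge_ereal_sup => _ [[x y] [/= Fx Fy] <-].
  rewrite lee_fin; move: Fx Fy; rewrite /F; case: ifP => // _.
  move=> [Sx /andP[x1 x2]] [Sy /andP[y1 y2]].
  apply: (le_trans (cK _ _ Sx Sy)); rewrite ler_pM2l// ler_norml.
  by move: x1 x2 y1 y2; rewrite -natr1 mulrDl mul1r => *; apply/andP; split; lra.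
apply: (@le_trans _ _ (\sum_(i <oo) ediam (F i))%E).
  apply: ereal_inf_lbound; exists F => //; split=> [x Sx|i]; last first.
    by apply: (le_trans (Fd i)); rewrite lee_fin.
  have /andP[ax xb] := cab _ Sx.
  have s0 : 0 <= (c x - a) / h by apply: divr_ge0; [rewrite subr_ge0|exact: ltW].
  have /andP[i1 i2] := truncn_itv s0.
  exists (Num.truncn ((c x - a) / h)) => //; rewrite /F ifT.
    split=> //=; move: i1 i2; rewrite ler_pdivlMr// ltr_pdivrMr// => i1 i2.
    by apply/andP; split; lra.
  rewrite -(ltr_nat R); apply: le_lt_trans i1 _.
  by rewrite ltr_pdivrMr// /h mulrC divfK ?gt_eqF// ltrBlDr subrK.
rewrite (@nneseries_split _ _ 0 N) => [|i _]; last exact: ediam_ge0.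
rewrite add0n [X in (_ + X)%E]eseries0 ?adde0; last first.
  by move=> i Ni _; rewrite /F ltnNge Ni /= ediam0.
apply: (@le_trans _ _ (\sum_(0 <= i < N) (K * h)%:E)%E); first exact: lee_sum.
rewrite sumEFin lee_fin big_mkord sumr_const card_ord -mulr_natr -mulrA.
by rewrite divfK ?gt_eqF.
Qed.

Lemma edot_ge0 (x : plane R) : 0 <= edot x x.
Proof. by rewrite addr_ge0// -expr2 sqr_ge0. Qed.

Lemma edotB (e x y : plane R) : edot e (x - y) = edot e x - edot e y.
Proof. by rewrite /edot /=; ring. Qed.

Lemma abs_edot_le (e x : plane R) : edot e e = 1 -> `|edot e x| <= 2 * `|x|.
Proof.
rewrite /edot => e1.
have coord (a b : R) : a * a + b * b = 1 -> `|a| <= 1.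
  move=> ab; rewrite -(@ler_pXn2r _ 2)// ?nnegrE// expr1n real_normK ?num_real//.
  by rewrite -ab expr2 lerDl -expr2 sqr_ge0.
apply: (le_trans (ler_normD _ _)); rewrite !normrM mulr_natl mulr2n.
have x1 : `|x.1| <= `|x| by rewrite plane_normE le_max lexx.
have x2 : `|x.2| <= `|x| by rewrite plane_normE le_max lexx orbT.
apply: lerD; rewrite -[leRHS]mul1r ler_pM//; first exact: coord e1.
by apply: (coord _ e.1); rewrite addrC.
Qed.

(** Within the ball where [Omega] is the strict epigraph of [gamma], boundary
    points lie on the graph itself: a point strictly below it has a
    neighbourhood that misses [Omega].  On the graph the abscissa [edot e] is
    a chart whose inverse is Lipschitz with constant [1 + L]. *)
Lemma lipschitz_boundary_local_length Omega q :
  open Omega -> lipschitz_boundary Omega -> boundary Omega q ->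
  exists2 r : R, 0 < r & (hausdorff1 (boundary Omega `&` ball q r) < +oo)%E.
Proof.
move=> oO lip bq; have [e [r [gamma [e1 r0 gl graph]]]] := lip q bq.
exists r => //; have [L L0 gL'] := pinfty_ex_gt0 gl.
have gL (a b : R) : `|gamma a - gamma b| <= L * `|a - b| by exact: (gL' (a, b)).
pose e' : plane R := (- e.2, e.1).
have ee : edot e e = 1.
  have : enorm e ^+ 2 = 1 by rewrite e1 expr1n.
  by rewrite sqr_sqrtr// edot_ge0.
have ee' : edot e' e' = 1 by rewrite -ee /edot /=; ring.
have on_graph x : (boundary Omega `&` ball q r) x -> edot e' x = gamma (edot e x).
  rewrite boundaryE// => -[[clx nOx] bx]; apply/eqP; rewrite eq_le.
  have -> /= : edot e' x <= gamma (edot e x).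
    by rewrite leNgt; apply/negP => /(graph x bx).
  rewrite leNgt; apply/negP; rewrite -subr_gt0 => lt.
  (* Within distance rho the ordinate moves by at most 2 rho and gamma of the
     abscissa by at most 2 L rho, which together just fill the gap. *)
  pose rho := (gamma (edot e x) - edot e' x) / (2 * (L + 1)).
  have rho0 : 0 < rho by rewrite divr_gt0// mulr_gt0// addr_gt0.
  have nbx : nbhs x (ball x rho `&` ball q r).
    apply: filterI; first exact: nbhsx_ballx.
    by apply: open_nbhs_nbhs; split => //; exact: ball_open.
  have [y [Oy [xy qy]]] := clx _ nbx.
  have := (graph y qy).1 Oy; apply/negP; rewrite -leNgt.
  have xy' : `|y - x| <= rho by move: xy; rewrite -ball_normE /= distrC => /ltW.
  have := gL (edot e y) (edot e x); rewrite -edotB.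
  have := abs_edot_le (y - x) ee'; have := abs_edot_le (y - x) ee.
  rewrite [in X in _ -> X]edotB => ly ly' lg.
  have lg' : `|gamma (edot e y) - gamma (edot e x)| <= L * (2 * rho).
    by apply: (le_trans lg); rewrite ler_pM2l//; apply: (le_trans ly); rewrite ler_pM2l.
  have rhoE : gamma (edot e x) - edot e' x = 2 * rho + L * (2 * rho).
    by rewrite /rho; field; rewrite gt_eqF// addr_gt0.
  have {}ly' := le_trans ly' (_ : _ <= 2 * rho).
  move: lg' ly'; rewrite !ler_norml -/e' ler_pM2l// => /andP[g1 _] /(_ xy')/andP[_ t2].
  lra.
have ab : edot e q - 2 * r < edot e q + 2 * r by lra.
have := @hausdorff1_le_chart (boundary Omega `&` ball q r) (edot e) (1 + L) _ _ _ ab.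
move=> /(_ _ _ _)/le_lt_trans; apply; rewrite ?ltry//; first by rewrite addr_gt0.
- move=> x [_]; rewrite -ball_normE /= distrC => xq.
  have := le_lt_trans (abs_edot_le (x - q) ee) (_ : _ < 2 * r).
  rewrite ltr_pM2l// => /(_ xq); rewrite edotB ltr_norml => /andP[x1 x2].
  by apply/andP; split; lra.
- move=> x y Sx Sy.
  have K0 : 0 <= (1 + L) * `|edot e x - edot e y| by rewrite mulr_ge0// addr_ge0// ltW.
  rewrite -(ger0_norm K0) -sqrtr_sqr; apply: ler_wsqrtr.
  have -> : edot (x - y) (x - y) = (edot e x - edot e y) ^+ 2
      + (edot e' x - edot e' y) ^+ 2.
    rewrite -!edotB -[LHS]mul1r -ee /edot /=; ring.
  rewrite (on_graph _ Sx) (on_graph _ Sy) -(real_normK (num_real (gamma _ - _))).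
  have := gL (edot e x) (edot e y); rewrite -(ler_pXn2r (n := 2))// ?nnegrE//; last first.
    by rewrite mulr_ge0// ltW.
  rewrite !exprMn !real_normK ?num_real// => h.
  have := sqr_ge0 (edot e x - edot e y).
  move: h; set A := _ ^+ 2; set B := (edot e x - edot e y) ^+ 2; nra.
Qed.

Lemma boundary_finite_length Omega :
  bounded_lipschitz_domain Omega -> (hausdorff1 (boundary Omega) < +oo)%E.
Proof.
move=> [oO _ _ bO lO].
have /choice[r rP] q : exists r : R, boundary Omega q ->
    0 < r /\ (hausdorff1 (boundary Omega `&` ball q r) < +oo)%E.
  have [bq|nbq] := pselect (boundary Omega q); last by exists 0.
  by have [r r0 rf] := lipschitz_boundary_local_length oO lO bq; exists r.
have := boundary_compact bO; rewrite compact_cover.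
move=> /(_ (plane R) (boundary Omega) (fun q => ball q (r q)))[].
- by move=> q _; exact: ball_open.
- by move=> q bq; exists q => //; apply: ballxx; exact: (rP q bq).1.
move=> X Xb cov.
have sub : boundary Omega `<=` \bigcup_(q in [set` X]) (boundary Omega `&` ball q (r q)).
  by move=> x bx; have [q Xq xq] := cov x bx; exists q.
apply: le_lt_trans (le_hausdorff1 sub) _; rewrite bigcup_fset.
rewrite big_seq; apply: (big_ind (fun A => (hausdorff1 A < +oo)%E)).
- by rewrite hausdorff1_set0.
- move=> A B fA fB; apply: le_lt_trans (outer_measureU2 hausdorff1_outer A B) _.
  exact: lte_add_pinfty.
- by move=> q /Xb/set_mem bq; exact: (rP q bq).2.
Qed.

End boundary_length.

(** * Linearity of the Cauchy-Riemann operator *)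

Section cauchy_riemann_linearity.
Context {R : realType} {k : plane R -> plane R -> R} {D : set (plane R)}.
Variables (H : rkhs k D) (q : plane R).
Hypothesis kC2 : class_C 2 (fun z : plane R * plane R => k z.1 z.2).
Hypothesis Dq : nbhs q D.

Lemma derive_rkhs_eval (v : plane R) :
  scalar (fun f : H => 'D_v (rkhs_eval f : plane R -> R^o) q : R).
Proof.
move=> t f g.
have df (h : H) : derivable (rkhs_eval h : plane R -> R^o) q v.
  exact: rkhs_derivable.
have -> : (rkhs_eval (t *: f + g) : plane R -> R^o) =
    t *: (rkhs_eval f : plane R -> R^o) + (rkhs_eval g : plane R -> R^o).
  by apply/funext => x; rewrite [LHS]rkhs_eval_scalar.
by rewrite deriveD ?deriveZ//; exact: derivableZ.
Qed.

Lemma cauchy_riemann_linear (t : R) (u w : H * H) :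
  cauchy_riemann (t *: u + w) q = t *: cauchy_riemann u q + cauchy_riemann w q.
Proof.
rewrite /cauchy_riemann /partial_x /partial_y /= !derive_rkhs_eval.
by congr pair => /=; rewrite /GRing.scale /=; ring.
Qed.

End cauchy_riemann_linearity.

(** * A bound for integrals of bounded functions *)

Section integral_bound.
Import HBNNSimple.

(** The integral of a nonnegative function, measurable or not, is a supremum over
    simple functions below it, and a nonnegative simple function that is at
    most [M] on [D] and vanishes elsewhere is at most [M] times the indicator
    of a measurable subset of [D]. *)
Lemma abs_Rintegral_le (d : measure_display) (T : measurableType d)
    (R : realType) (mu : {measure set T -> \bar R}) (D : set T) (f : T -> R)
    (M c : R) : 0 <= M -> 0 <= c ->
  (forall x, D x -> `|f x| <= M) ->
  (forall A, measurable A -> A `<=` D -> (mu A <= c%:E)%E) ->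
  `|\int[mu]_(x in D) f x| <= M * c.
Proof.
move=> M0 c0 fM muc.
have bound (g : T -> \bar R) : (forall x, 0 <= g x)%E ->
    (forall x, g x <= M%:E)%E -> (forall x, ~ D x -> g x = 0%E) ->
    (0 <= \int[mu]_x g x <= (M * c)%:E)%E.
  move=> g0 gM gD; rewrite integral_ge0//= ge0_integralTE//.
  apply: ge_ereal_sup => _ [h hg <-].
  pose A := ~` (h @^-1` [set 0]).
  have mA : measurable A by apply: measurableC; exact: measurable_funPTI.
  have AD : A `<=` D.
    move=> x /= hx; apply: contrapT => /gD gx0; apply: hx.
    by have := hg x; rewrite gx0 lee_fin => hx0; apply/eqP; rewrite eq_le hx0 fun_ge0.
  apply: (@le_trans _ _ (sintegral mu (scale_nnsfun (indic_nnsfun R mA) M0))).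
    apply: le_sintegral => x; rewrite [leRHS]/= /measurable_realfun.mindic indicE.
    have [xA|] := boolP (x \in A).
      by rewrite mulr1 -lee_fin (le_trans (hg x)).
    by rewrite notin_setE /A /= => /contrapT ->; rewrite mulr0.
  rewrite sintegralrM sintegral_indic// EFinM lee_pmul// ?lee_fin//.
  exact: muc.
have part (g : T -> \bar R) : (forall x, D x -> 0 <= g x <= M%:E)%E ->
    (0 <= \int[mu]_(x in D) g x <= (M * c)%:E)%E.
  move=> gM; rewrite integral_mkcond; apply: bound => x; rewrite patchE;
    case: (boolP (x \in D)) => //.
  - by move=> /set_mem/gM/andP[].
  - by move=> /set_mem/gM/andP[].
  - by move=> /set_mem.
have /andP[p0 pM] : (0 <= \int[mu]_(x in D) (EFin \o f)^\+ x <= (M * c)%:E)%E.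
  apply: part => x /fM fx; rewrite funeposE /= -EFin_max !lee_fin.
  by rewrite le_max lexx orbT/= ge_max M0 andbT (le_trans (ler_norm _)).
have /andP[n0 nM] : (0 <= \int[mu]_(x in D) (EFin \o f)^\- x <= (M * c)%:E)%E.
  apply: part => x /fM fx; rewrite funenegE /= -EFin_max !lee_fin.
  by rewrite le_max lexx orbT/= ge_max M0 andbT (le_trans (ler_norm _)) ?normrN.
rewrite /Rintegral integralE.
move: p0 pM n0 nM; rewrite /comp.
case: (\int[mu]_(x in D) _)%E => [p|//|//]; case: (\int[mu]_(x in D) _)%E => [n|//|//].
rewrite !lee_fin /= => p0 pM n0 nM.
by rewrite ler_norml; apply/andP; split; lra.
Qed.

End integral_bound.

(** * The boundary functional *)

Section boundary_functional.
Context {R : realType} {Omega : set (plane R)} {k : plane R -> plane R -> R}.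
Variables (H : rkhs k Omega) (Hc : rkhs k (closure Omega))
  (Hb : rkhs k (boundary Omega)).
Variables (ext : H -> Hc) (hext : is_isometric_extension ext)
  (res : Hc -> Hb) (hres : is_restriction res).

Lemma continuous_kernel_boundary_bound :
  bounded_set Omega -> continuous (fun z : plane R * plane R => k z.1 z.2 : R^o) ->
  exists2 K : R, 0 < K & forall q, boundary Omega q -> k q q <= K.
Proof.
move=> bO kc.
have diag : continuous (fun q : plane R => k q q : R^o).
  move=> q.
  apply: (@continuous_comp _ _ _ (fun q : plane R => (q, q))
    (fun z : plane R * plane R => k z.1 z.2 : R^o)); last exact: kc.
  exact: (cvg_pair cvg_id cvg_id).
have := continuous_compact (continuous_subspaceT diag) (boundary_compact bO).
move=> /compact_bounded/pinfty_ex_gt0[K K0 KP]; exists K => // q bq.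
by apply: (le_trans (ler_norm _)); apply: (KP (k q q)); exists q.
Qed.

(** The extension is isometric and restriction preserves values, so the bound
    by the reproducing property in the space over the closure carries over to
    traces. *)
Lemma trace_bound (K : R) (f : H) (q : plane R) :
  (forall q, boundary Omega q -> k q q <= K) -> boundary Omega q ->
  rkhs_eval (res (ext f)) q ^+ 2 <= K * `|f| ^+ 2.
Proof.
move=> kK bq; rewrite hres// -(hext.2 f).
have cq : closure Omega q by case: bq.
apply: (le_trans (rkhs_eval_bound _ cq)).
by rewrite ler_wpM2r ?sqr_ge0// kK.
Qed.

Lemma boundary_integral_trace_bound : bounded_lipschitz_domain Omega ->
  continuous (fun z : plane R * plane R => k z.1 z.2 : R^o) ->
  exists2 C : R, 0 < C & forall (g : Hb * Hb) (v : H * H),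
    `|boundary_integral g (trace2 ext res v)| <= C * norm2 g * norm2 v.
Proof.
move=> dom kc; have bO : bounded_set Omega by case: dom.
have [K K0 kK] := continuous_kernel_boundary_bound bO kc.
have fin := boundary_finite_length dom.
have L0 : 0 <= fine (hausdorff1 (boundary Omega)) by rewrite fine_ge0// hausdorff1_ge0.
(* The summand 1 keeps the constant positive if the boundary has length 0. *)
exists (K * (fine (hausdorff1 (boundary Omega)) + 1)) => [|g v].
  by rewrite mulr_gt0// ltr_wpDl.
have M0 : 0 <= K * norm2 g * norm2 v by rewrite !mulr_ge0 ?sqrtr_ge0// ltW.
apply: (@le_trans _ _ (K * norm2 g * norm2 v *
  fine (hausdorff1 (boundary Omega)))); last first.
  rewrite (_ : K * _ * norm2 g * norm2 v = K * norm2 g * norm2 v *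
    (fine (hausdorff1 (boundary Omega)) + 1)); last by ring.
  by rewrite ler_wpM2l// lerDl.
apply: abs_Rintegral_le => // [q bq|A _ Ab]; last first.
  rewrite fineK; first exact: le_hausdorff1.
  by rewrite ge0_fin_numE// hausdorff1_ge0.
rewrite -(@ler_pXn2r _ 2)// ?nnegrE// real_normK ?num_real//.
have g1 : rkhs_eval g.1 q ^+ 2 <= K * `|g.1| ^+ 2.
  by apply: (le_trans (rkhs_eval_bound _ bq)); rewrite ler_wpM2r ?sqr_ge0// kK.
have g2 : rkhs_eval g.2 q ^+ 2 <= K * `|g.2| ^+ 2.
  by apply: (le_trans (rkhs_eval_bound _ bq)); rewrite ler_wpM2r ?sqr_ge0// kK.
have v1 := trace_bound v.1 kK bq; have v2 := trace_bound v.2 kK bq.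
rewrite /= !exprMn !norm2_sqr /inner2 !inner_norm.
apply: (@le_trans _ _ ((rkhs_eval g.1 q ^+ 2 + rkhs_eval g.2 q ^+ 2) *
  (rkhs_eval (res (ext v.1)) q ^+ 2 + rkhs_eval (res (ext v.2)) q ^+ 2))).
  rewrite -subr_ge0; set x := rkhs_eval g.1 q; set y := rkhs_eval g.2 q.
  set z := rkhs_eval _ q; set w := rkhs_eval _ q.
  rewrite (_ : _ - _ = (x * w - y * z) ^+ 2) ?sqr_ge0//; ring.
rewrite (_ : K ^+ 2 * _ * _ = (K * `|g.1| ^+ 2 + K * `|g.2| ^+ 2) *
  (K * `|v.1| ^+ 2 + K * `|v.2| ^+ 2)); last by ring.
by apply: ler_pM; rewrite ?addr_ge0 ?sqr_ge0 ?lerD.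
Qed.

End boundary_functional.

(** * The penalty form of the Cauchy-Riemann equations *)

Section cauchy_riemann_form.
Context {R : realType} {k : plane R -> plane R -> R} {D : set (plane R)}.
Variables (H : rkhs k D) (n : nat) (p : 'I_n -> plane R).
Hypothesis kC2 : class_C 2 (fun z : plane R * plane R => k z.1 z.2).
Hypothesis Dp : forall l, nbhs (p l) D.
Hypothesis n0 : (0 < n)%N.

Definition cauchy_riemann_form (u v : H * H) : R :=
  n%:R^-1 * \sum_(l < n) edot (cauchy_riemann u (p l)) (cauchy_riemann v (p l)).

Let nR0 : 0 < n%:R :> R. Proof. by rewrite ltr0n. Qed.

Lemma cauchy_riemann_form_psd : psd_form cauchy_riemann_form.
Proof.
rewrite /cauchy_riemann_form; split=> [u v|t u v w|u].
- by congr (_ * _); apply: eq_bigr => l _; rewrite /edot; ring.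
- rewrite [t * _]mulrCA -mulrDr; congr (_ * _); rewrite mulr_sumr -big_split /=.
  apply: eq_bigr => l _; rewrite cauchy_riemann_linear//.
  by rewrite /edot /= /GRing.scale /=; ring.
- by rewrite mulr_ge0 ?invr_ge0 ?(ltW nR0)// sumr_ge0// => l _; exact: edot_ge0.
Qed.

Lemma sum_edot_cauchy_riemann (u v : H * H) :
  \sum_(l < n) edot (cauchy_riemann u (p l)) (cauchy_riemann v (p l)) =
  n%:R * cauchy_riemann_form u v.
Proof. by rewrite /cauchy_riemann_form mulVKf// gt_eqF. Qed.

Lemma edot_cauchy_riemann_le (u : H * H) l :
  edot (cauchy_riemann u (p l)) (cauchy_riemann u (p l)) <=
  n%:R * cauchy_riemann_form u u.
Proof.
rewrite -sum_edot_cauchy_riemann (bigD1 l)//= lerDl sumr_ge0// => *; exact: edot_ge0.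
Qed.

Lemma cauchy_riemann_form_null (u : H * H) :
  cauchy_riemann_form u u = 0 <-> cauchy_riemann_kernel p u.
Proof.
split=> [u0 l|u0]; last first.
  rewrite /cauchy_riemann_form big1 ?mulr0// => l _.
  by rewrite u0 /edot /= !mul0r addr0.
have := edot_cauchy_riemann_le u l; rewrite u0 mulr0.
case: (cauchy_riemann u (p l)) => x y; rewrite /edot /= => le0.
have := sqr_ge0 x; have := sqr_ge0 y; rewrite !expr2 => y0 x0.
have /eqP : x * x = 0 by lra.
have /eqP : y * y = 0 by lra.
by rewrite -!expr2 !sqrf_eq0 => /eqP-> /eqP->.
Qed.

(** The null space of the penalty is the common kernel of the [2 n] coordinate
    functionals of [v |-> Bv(p_l)], indexed here by ['I_n * bool]. *)
Lemma cauchy_riemann_source (a : H * H -> H * H -> R) (phi2 : H * H) :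
  psd_form a -> (forall v, cauchy_riemann_kernel p v -> a phi2 v = 0) ->
  exists2 c, 0 <= c & forall v, a phi2 v ^+ 2 <= c * cauchy_riemann_form v v.
Proof.
move=> ha perp.
pose b (i : 'I_n * bool) (v : H * H) :=
  if i.2 then (cauchy_riemann v (p i.1)).1 else (cauchy_riemann v (p i.1)).2.
have [i t u v|t u v|v bv|c c0 hc] :=
    @dominated_of_common_kernel R (H * H)%type _ b (index_enum _) (a phi2).
- by rewrite /b; case: i.2; rewrite cauchy_riemann_linear.
- by rewrite (psd_formDr ha) (psd_formZr ha).
- apply: perp => l.
  have x0 : (cauchy_riemann v (p l)).1 = 0 := bv (l, true) (mem_index_enum _).
  have y0 : (cauchy_riemann v (p l)).2 = 0 := bv (l, false) (mem_index_enum _).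
  by rewrite [LHS]surjective_pairing x0 y0.
exists (c * n%:R) => [|v]; first by rewrite mulr_ge0.
rewrite -mulrA -sum_edot_cauchy_riemann; apply: (le_trans (hc v)).
rewrite ler_wpM2l// le_eqVlt; apply/orP; left; apply/eqP.
rewrite -(pair_bigA _ (fun l i => b (l, i) v ^+ 2)) /=; apply: eq_bigr => l _.
by rewrite big_bool /b /= /edot -!expr2.
Qed.

End cauchy_riemann_form.

(** * The regularised solution and its limits *)

Lemma cvg0_of_sqr_le (R : realType) (T : Type) (F : set_system T)
    {FF : Filter F} (f g : T -> R) :
  g x @[x --> F] --> 0 ->
  (\forall x \near F, 0 <= f x /\ f x ^+ 2 <= g x) ->
  f x @[x --> F] --> 0.
Proof.
move=> g0 fg.
apply: (@squeeze_cvgr _ _ _ _ (cst 0) (fun x => Num.sqrt (g x))); last 2 first.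
- exact: cvg_cst.
- rewrite -[X in _ --> X](sqrtr0 R).
  by apply: (continuous_cvg _ (@sqrt_continuous R 0)).
near=> x; have [f0 fx] : 0 <= f x /\ f x ^+ 2 <= g x by near: x.
by rewrite f0 /= -[f x](ger0_norm f0) -sqrtr_sqr ler_wsqrtr.
Unshelve. all: by end_near. Qed.

Theorem proposition4p5 (R : realType) (Omega : set (plane R))
    (k : plane R -> plane R -> R)
    (hOmega : bounded_lipschitz_domain Omega)
    (hkC2 : class_C 2 (fun z : plane R * plane R => k z.1 z.2))
    (hksym : symmetric_kernel k)
    (hkpd : positive_definite_kernel k)
    (H : rkhs k Omega) (Hc : rkhs k (closure Omega))
    (Hb : rkhs k (boundary Omega))
    (ext : {linear H -> Hc}) (hext : is_isometric_extension ext)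
    (res : {linear Hc -> Hb}) (hres : is_restriction res) :
  let tr := trace2 ext res in
  exists2 C : R, 0 < C &
  forall (n : nat) (p : 'I_n -> plane R) (g : Hb * Hb)
    (phi phi1 phi2 : H * H) (u u1 u2 : R -> H * H),
  let V : set (H * H) := cauchy_riemann_kernel p in
  let Vperp := orthogonal_complement V in
  (0 < n)%N ->
  (forall l, Omega (p l)) ->
  (forall v, inner2 phi v = boundary_integral g (tr v)) ->
  (forall alpha, 0 < alpha ->
     forall w, energy tr p g alpha (u alpha) <= energy tr p g alpha w) ->
  phi = phi1 + phi2 -> V phi1 -> Vperp phi2 ->
  (forall alpha, 0 < alpha ->
     [/\ u alpha = u1 alpha + u2 alpha, V (u1 alpha) & Vperp (u2 alpha)]) ->
  [/\ (* (i) *)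
      forall alpha, 0 < alpha -> u1 alpha = phi1,
      (* (ii) *)
      forall alpha, 0 < alpha -> norm2 (u2 alpha) <= C * norm2 g,
      (* (iii) *)
      forall alpha, 0 < alpha -> forall v2, Vperp v2 ->
        n%:R^-1 * (\sum_(l < n) edot (cauchy_riemann (u2 alpha) (p l))
                                     (cauchy_riemann v2 (p l)))
        + alpha * inner2 (u2 alpha) v2
        = alpha * boundary_integral g (tr v2),
      (* (iv) *)
      (norm2 (u alpha - phi1) @[alpha --> 0^'+] --> (0 : R)) /\
      ((Num.sqrt alpha)^-1 *
         \big[Num.max/0]_(l < n) enorm (cauchy_riemann (u alpha) (p l))
         @[alpha --> 0^'+] --> (0 : R)) &
      (* (v) *)
      norm2 (u alpha - phi) @[alpha --> +oo] --> (0 : R)].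
Proof.
move=> tr; case: (hOmega) => oO _ _ _ _; have kc := hkC2.1.
have [C C0 hC] := boundary_integral_trace_bound hext hres hOmega kc.
exists C => // n p g phi phi1 phi2 u u1 u2 V Vperp n0 Op hphi umin phiE Vphi1 Pphi2 uE.
have Np l : nbhs (p l) Omega by apply: open_nbhs_nbhs.
have a_psd := inner2_psd H.
have q_psd := cauchy_riemann_form_psd H hkC2 Np n0.
pose a : H * H -> H * H -> R := @inner2 R _ k Omega H.
pose q := @cauchy_riemann_form R k Omega H n p.
have nullV v : q v v = 0 -> V v by move/(cauchy_riemann_form_null p n0).
have Vnull v : V v -> q v v = 0 by move/(cauchy_riemann_form_null p n0).
have perp w : Vperp w -> forall v, q v v = 0 -> a w v = 0.
  by move=> Pw v /nullV; exact: Pw.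
(* By hphi the boundary functional is the inner product with phi; this is also
   where its linearity comes from. *)
have energyE alpha w : energy tr p g alpha w = tikhonov a q phi alpha w.
  rewrite /energy /tikhonov norm2_sqr -hphi /q /cauchy_riemann_form.
  congr (2^-1 * (_ * _ + _) - _); apply: eq_bigr => l _.
  by rewrite sqr_sqrtr// edot_ge0.
have el alpha : 0 < alpha -> forall v,
    q (u alpha) v + alpha * a (u alpha) v = alpha * a phi v.
  move=> a0; apply: (tikhonov_euler_lagrange a_psd q_psd a0) => w.
  by rewrite -!energyE; exact: umin.
have partI alpha : 0 < alpha -> u1 alpha = phi1.
  move=> a0; have [e V1 P2] := uE _ a0; have := el _ a0; rewrite e => el'.
  apply: (tikhonov_null_part a_psd q_psd a0 (@inner2_definite _ _ _ _ H) phiE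
    (Vnull _ Vphi1) (perp _ Pphi2) (Vnull _ V1) (perp _ P2) el').
have el2 alpha : 0 < alpha -> forall v,
    q (u2 alpha) v + alpha * a (u2 alpha) v = alpha * a phi2 v.
  move=> a0; have [e V1 P2] := uE _ a0; have := el _ a0; rewrite e => el'.
  apply: (tikhonov_perp_part a_psd q_psd a0 (@inner2_definite _ _ _ _ H) phiE
    (Vnull _ Vphi1) (perp _ Pphi2) (Vnull _ V1) (perp _ P2) el').
have [c c0 source] := cauchy_riemann_source hkC2 Np n0 a_psd Pphi2.
have small alpha (a0 : 0 < alpha) := tikhonov_small a_psd q_psd a0 (el2 _ a0) c0 source.
have crE alpha l : 0 < alpha ->
    cauchy_riemann (u alpha) (p l) = cauchy_riemann (u2 alpha) (p l).
  move=> a0; have [-> V1 _] := uE _ a0.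
  by rewrite -[u1 alpha]scale1r (cauchy_riemann_linear hkC2 (Np l)) V1 scaler0 add0r.
split.
- exact: partI.
- move=> alpha a0.
  have phi2_le : norm2 phi2 <= C * norm2 g.
    have [->|phi20] := eqVneq (norm2 phi2) 0.
      by rewrite mulr_ge0 ?sqrtr_ge0// ltW.
    have phi2_gt0 : 0 < norm2 phi2 by rewrite lt_def phi20 sqrtr_ge0.
    rewrite -(ler_pM2r phi2_gt0) -expr2 norm2_sqr.
    have -> : inner2 phi2 phi2 = inner2 phi phi2.
      rewrite phiE (psd_formDl a_psd) (psd_formC a_psd phi1).
      by rewrite (Pphi2 _ Vphi1) add0r.
    by rewrite hphi; apply: (le_trans (ler_norm _)); exact: hC.
  apply: le_trans phi2_le; apply: ler_wsqrtr.
  exact: (tikhonov_contraction a_psd q_psd a0 (el2 _ a0)).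
- move=> alpha a0 v2 Pv2; rewrite -hphi.
  have := el2 _ a0 v2; rewrite /q /cauchy_riemann_form => ->.
  congr (_ * _); rewrite phiE (psd_formDl a_psd).
  by rewrite (psd_formC a_psd phi1) (Pv2 _ Vphi1) add0r.
- have lin_to0 (K : R) : K * alpha @[alpha --> 0^'+] --> 0.
    apply: cvg_at_right_filter; rewrite -[X in _ --> X](mulr0 K).
    by apply: cvgM; [exact: cvg_cst|exact: cvg_id].
  split.
  + apply: (cvg0_of_sqr_le (lin_to0 c)); near=> alpha.
    have a0 : 0 < alpha by near: alpha; exact: nbhs_right_gt.
    split; first exact: sqrtr_ge0.
    have [-> _ _] := uE _ a0.
    by rewrite partI// addrAC subrr add0r norm2_sqr; exact: (small _ a0).1.
  + apply: (cvg0_of_sqr_le (lin_to0 (n%:R * c))); near=> alpha.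
    have a0 : 0 < alpha by near: alpha; exact: nbhs_right_gt.
    have Q0 : 0 <= n%:R * q (u2 alpha) (u2 alpha).
      by rewrite mulr_ge0// (psd_form_ge0 q_psd).
    have max0 : 0 <= \big[Num.max/0]_(l < n) enorm (cauchy_riemann (u alpha) (p l)).
      exact: bigmax_ge_id.
    split; first by rewrite mulr_ge0// invr_ge0 sqrtr_ge0.
    rewrite exprMn exprVn sqr_sqrtr ?(ltW a0)// mulrC ler_pdivrMr// -!mulrA -expr2.
    apply: (@le_trans _ _ (n%:R * q (u2 alpha) (u2 alpha))); last first.
      by rewrite ler_wpM2l//; exact: (small _ a0).2.
    rewrite -[leRHS]sqr_sqrtr//; apply: lerXn2r; rewrite ?nnegrE ?sqrtr_ge0//.
    apply: bigmax_le; first exact: sqrtr_ge0.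
    move=> l _; rewrite crE//; apply: ler_wsqrtr.
    exact: edot_cauchy_riemann_le.
- have inv_to0 : q phi2 phi2 * alpha^-1 @[alpha --> +oo] --> 0.
    rewrite -[X in _ --> X](mulr0 (q phi2 phi2)); apply: cvgM; first exact: cvg_cst.
    apply/gtr0_cvgV0; last exact: cvg_id.
    exact: nbhs_pinfty_gt.
  apply: (cvg0_of_sqr_le inv_to0); near=> alpha.
  have a0 : 0 < alpha by near: alpha; exact: nbhs_pinfty_gt.
  split; first exact: sqrtr_ge0.
  have [-> _ _] := uE _ a0; rewrite norm2_sqr partI// phiE.
  rewrite (_ : _ - _ = u2 alpha - phi2); last by rewrite opprD addrACA subrr add0r.
  exact: (tikhonov_large a_psd q_psd a0 (el2 _ a0)).
Unshelve. all: by end_near. Qed.
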